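(* Let $m\in\mathbb{N}$ and let $f\colon\mathbb{R}_+^m\to\mathbb{R}_+$ be a symmetric function which preserves positive semi-definiteness. Then $f$ has a power series expansion $$f(x_1,\dotsc,x_m)=\sum_{(p_1,\dotsc,p_m)\in\mathbb{Z}_+^m}a_{p_1,\dotsc,p_m}\,x_1^{p_1}\dotsm x_m^{p_m},\qquad (x_1,\dotsc,x_m)\in\mathbb{R}_+^m,$$ where $a_{p_1,\dotsc,p_m}\in\mathbb{R}_+$ for all $(p_1,\dotsc,p_m)\in\mathbb{Z}_+^m$.
   Context: $\mathbb{N}$ is the set of positive integers, $\mathbb{Z}_+$ the set of non-negative integers, $\mathbb{R}_+=[0,\infty)$ the set of non-negative real numbers; $x^0=1$ for all $x\in\mathbb{R}_+$. A function $f$ on $\mathbb{R}_+^m$ is symmetric if $f(x_1,\dotsc,x_m)=f(x_{\pi(1)},\dotsc,x_{\pi(m)})$ for all $(x_1,\dotsc,x_m)\in\mathbb{R}_+^m$ and all permutations $\pi$ of $\{1,\dotsc,m\}$. For such $f$ and a positive semi-definite complex $m\times m$ matrix $A$ with eigenvalues $\lambda_1(A),\dotsc,\lambda_m(A)$, counted with algebraic multiplicity, set $f(A):=f(\lambda_1(A),\dotsc,\lambda_m(A))$. A symmetric function $f\colon\mathbb{R}_+^m\to\mathbb{C}$ preserves positive semi-definiteness if for every $n\in\mathbb{N}$ the following holds: whenever $[A_{\alpha\beta}]_{\alpha,\beta=1,\dotsc,n}$ is an $n\times n$ block matrix whose blocks $A_{\alpha\beta}$ are all positive semi-definite complex $m\times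 m$ matrices and which is positive semi-definite as a complex $nm\times nm$ matrix, then the $n\times n$ matrix $[f(A_{\alpha\beta})]_{\alpha,\beta=1,\dotsc,n}$ is positive semi-definite. (Positive semi-definite matrices are in particular Hermitian.) *)

(* Defs.v *)
From HB Require Import structures.
From mathcomp Require Import all_boot all_order all_fingroup all_algebra.
From mathcomp Require Import all_classical all_reals all_analysis.
From mathcomp Require Import complex.

Set Implicit Arguments.
Unset Strict Implicit.
Unset Printing Implicit Defensive.

Import Order.TTheory GRing.Theory Num.Theory.

Local Open Scope ring_scope.
Local Open Scope sesquilinear_scope.
Local Open Scope complex_scope.

(* The order on C is the partial one: [0 <= z] says that z is real and
   nonnegative. *)
Definition psdmx (C : numClosedFieldType) (n : nat) (A : 'M[C]_n) : Prop :=
  A \is hermsymmx /\ forall x : 'cV[C]_n, 0 <= (x^t* *m A *m x) 0 0.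

(* The roots of the characteristic polynomial, repeated according to their
   algebraic multiplicities, in an unspecified order. *)
Definition eigenvalues (C : closedFieldType) (m : nat) (A : 'M[C]_m) : seq C :=
  sval (closed_field_poly_normal (char_poly A)).

Lemma char_poly_eigenvalues (C : closedFieldType) (m : nat) (A : 'M[C]_m) :
  char_poly A = \prod_(z <- eigenvalues A) ('X - z%:P).
Proof.
rewrite /eigenvalues; case: closed_field_poly_normal => s /= {1}->.
by rewrite (monicP (char_poly_monic A)) scale1r.
Qed.

Lemma size_eigenvalues (C : closedFieldType) (m : nat) (A : 'M[C]_m) :
  size (eigenvalues A) = m.
Proof.
have := size_char_poly A.
by rewrite char_poly_eigenvalues size_prod_XsubC => -[].
Qed.

Definition nonneg_vec (R : realType) (m : nat) (x : 'rV[R]_m) : Prop :=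
  forall i, 0 <= x 0 i.

(* Functions on the nonnegative orthant are represented by total functions on
   R^m, whose values outside the orthant are never constrained or used. *)
Definition symmetric_fun (R : realType) (m : nat) (T : Type)
    (f : 'rV[R]_m -> T) : Prop :=
  forall (x : 'rV[R]_m) (s : 'S_m), nonneg_vec x -> f (col_perm s x) = f x.

(* f(A) = f(lambda_1(A), ..., lambda_m(A)), meant for A positive semi-definite
   (so that the eigenvalues are nonnegative reals and taking the real part only
   changes their type) and f symmetric (so that their order is irrelevant). *)
Definition fun_mx (R : realType) (m : nat) (T : Type) (f : 'rV[R]_m -> T)
    (A : 'M[R[i]]_m) : T :=
  f (\row_(i < m) complex.Re (nth 0 (eigenvalues A) i)).

Definition preserves_psd (R : realType) (m : nat) (f : 'rV[R]_m -> R[i]) :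
    Prop :=
  forall (n : nat) (A : 'I_n -> 'I_n -> 'M[R[i]]_m),
    (0 < n)%N ->
    (forall a b, psdmx (A a b)) ->
    psdmx (\mxblock_(a < n, b < n) A a b) ->
    psdmx (\matrix_(a < n, b < n) fun_mx f (A a b)).

(* Main.v *)
Require Import Defs.
From HB Require Import structures.
From mathcomp Require Import all_boot all_order perm all_algebra.
From mathcomp Require Import all_classical all_reals all_analysis.
From mathcomp Require Import complex ring lra.

(** Diagonal blocks turn the hypothesis into a statement about scalar kernels:
if [K a b] is a symmetric matrix of vectors of the nonnegative orthant, each of
whose coordinates is a positive semi-definite kernel, then [f (K a b)] is a
positive semi-definite kernel ([preserves_psd_kernels]; the symmetry of [f]
makes the order of the eigenvalues harmless).

The class of functions with this property is stable under every forward
difference [g |-> g (x + v) - g x] with [v] in the orthant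
([preserves_kernels_fdiff]): the doubled kernel with blocks [K, K; K, K + v] is
again positive semi-definite, and testing its image under [g] against vectors
of the form [(- z, z)] gives the quadratic form of [g (K + v) - g K].  Since a
member of the class is nonnegative on the orthant, all the iterated forward
differences of [f] are nonnegative: [f] is absolutely monotone.

It remains to prove a theorem of Bernstein in several variables,
[absolutely_monotone_series].  On the grid of mesh [h], the Newton interpolation
formula writes [f] as a finite combination, with nonnegative coefficients
[c (h, p)], of products over [i] of the falling factorials
[x_i (x_i - h) ... (x_i - (p_i - 1) h)].  Three facts allow [h] to tend to 0
along the powers of 1/2, without any regularity assumption on [f].
 - The coefficients decrease when [h] is halved ([newton_coef_half]), because
   the difference of step [2 h] is the sum of two differences of step [h], the
   second one taken at a larger point; so [c (h, p)] tends to some [a p >= 0].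
 - The falling factorials tend to the monomials [x ^ p] ([cvg_step_ffact]).
 - Doubling the argument multiplies a falling factorial of order [p] by at least
   [2 ^ p], so the terms whose multi-index has an entry above [K] contribute at
   most [f (2 x) / 2 ^ K] ([newton_box_sum_ge]): the tails of the Newton
   expansions are small uniformly in [h].
A point [x] outside the grids is squeezed between its lower and upper grid
neighbours, using that [f] is nondecreasing. *)

Set Implicit Arguments.
Unset Strict Implicit.
Unset Printing Implicit Defensive.

Import Order.TTheory GRing.Theory Num.Theory numFieldNormedType.Exports.

Local Open Scope ring_scope.

(** * Positive semi-definite kernels and diagonal blocks *)

Definition psd_kernel (C : numClosedFieldType) (T : finType)
    (K : T -> T -> C) : Prop :=
  forall z : T -> C, 0 <= \sum_a \sum_b (z a)^* * K a b * z b.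

Local Open Scope sesquilinear_scope.

Lemma psdmxP (C : numClosedFieldType) (n : nat) (A : 'M[C]_n) :
  psdmx A <->
  (forall i j, A i j = (A j i)^*) /\ psd_kernel (fun i j => A i j).
Proof.
have quadE (x : 'cV[C]_n) :
    (x^t* *m A *m x) 0 0 = \sum_a \sum_b (x a 0)^* * A a b * x b 0.
  rewrite mxE exchange_big /=; apply: eq_bigr => j _.
  by rewrite mxE mulr_suml; apply: eq_bigr => i _; rewrite !mxE.
split=> -[hA pA]; split.
- move=> i j; move/is_hermitianmxP: hA; rewrite expr0 scale1r => hA.
  by rewrite [in LHS]hA !mxE.
- move=> z; have := pA (\col_i z i); rewrite quadE.
  by under eq_bigr do under eq_bigr do rewrite !mxE.
- apply/is_hermitianmxP; rewrite expr0 scale1r.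
  by apply/matrixP => i j; rewrite !mxE.
- by move=> x; rewrite quadE; exact: pA.
Qed.

(** The factorization of the characteristic polynomial determines its roots with
their multiplicities, but not their order. *)
Lemma eigenvalues_diag (C : closedFieldType) (m : nat) (d : 'rV[C]_m) :
  perm_eq (eigenvalues (diag_mx d)) [seq d 0 i | i <- enum 'I_m].
Proof.
apply: prod_XsubC_eq; rewrite -char_poly_eigenvalues.
rewrite char_poly_trig ?diag_mx_is_trig //.
rewrite big_map enumT; apply: eq_bigr => i _.
by rewrite mxE eqxx mulr1n.
Qed.

Lemma fun_mx_diag (R : realType) (m : nat) (T : Type) (f : 'rV[R]_m -> T)
    (d : 'rV[R]_m) : symmetric_fun f -> nonneg_vec d ->
  fun_mx f (diag_mx (map_mx (real_complex R) d)) = f d.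
Proof.
move=> f_sym d_ge0; rewrite /fun_mx.
have dE : [seq map_mx (real_complex R) d 0 i | i <- enum 'I_m] =
    [tuple (d 0 i)%:C%C | i < m] :> seq _.
  by rewrite -val_ord_tuple; apply: eq_map => i; rewrite mxE.
have := eigenvalues_diag (map_mx (real_complex R) d).
rewrite dE => /tuple_permP[s sE].
rewrite -(f_sym d s d_ge0); congr f; apply/rowP => i; rewrite !mxE sE.
by rewrite -tnth_nth tnth_mktuple tnth_mktuple.
Qed.

Lemma sum_mxblock_index (V : nmodType) (n m : nat)
    (F : 'I_(\sum_(a < n) m) -> V) :
  \sum_s F s = \sum_(a < n) \sum_(i < m) F (@tagnat.Rank n (fun=> m) a i).
Proof.
rewrite (@sig_big_dep _ _ _ _ _ xpredT (fun _ => xpredT)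
  (fun a i => F (@tagnat.Rank n (fun=> m) a i))) /=.
rewrite (reindex _ (@tagnat.sig_bij_on n (fun=> m))) /=.
by apply: eq_bigr => s _; rewrite -[in LHS](tagnat.sig2K s).
Qed.

(** With diagonal blocks, the coordinates do not interact: the quadratic form of
the block matrix is the sum, over the coordinates, of those of the kernels. *)
Lemma psd_kernel_diag_mxblock (C : numClosedFieldType) (n m : nat)
    (K : 'I_n -> 'I_n -> 'rV[C]_m) :
  (forall i, psd_kernel (fun a b => K a b 0 i)) ->
  psd_kernel (fun s t => (\mxblock_(a < n, b < n) diag_mx (K a b)) s t).
Proof.
move=> K_psd z; rewrite sum_mxblock_index.
pose w a i := z (@tagnat.Rank n (fun=> m) a i).
rewrite (eq_bigr (fun a => \sum_i \sum_b (w a i)^* * K a b 0 i * w b i)).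
  by rewrite exchange_big; apply: sumr_ge0 => i _; exact: K_psd.
move=> a _; apply: eq_bigr => i _; rewrite sum_mxblock_index.
apply: eq_bigr => b _; rewrite (bigD1 i) //= [X in _ + X]big1 ?addr0.
  have := congr1 (fun M : 'M[C]_m => M i i)
    (mxblockK (fun a b => diag_mx (K a b)) a b).
  by rewrite mxE => ->; rewrite mxE eqxx mulr1n.
move=> j ji; have := congr1 (fun M : 'M[C]_m => M i j)
  (mxblockK (fun a b => diag_mx (K a b)) a b).
by rewrite mxE => ->; rewrite mxE eq_sym (negbTE ji) mulr0n mulr0 mul0r.
Qed.

(** The commutative counterpart of [preserves_psd].  Arbitrary finite index
types make room for the index type [bool * T] of doubled kernels. *)
Definition preserves_kernels (R : realType) (m : nat) (g : 'rV[R]_m -> R) :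
    Prop :=
  forall (T : finType) (K : T -> T -> 'rV[R]_m),
    (forall a b, nonneg_vec (K a b)) ->
    (forall a b, K a b = K b a) ->
    (forall i, psd_kernel (fun a b => (K a b 0 i)%:C%C)) ->
    psd_kernel (fun a b => (g (K a b))%:C%C).

Lemma conj_real (R : realType) (x : R) : (x%:C%C)^* = x%:C%C.
Proof. by rewrite /= /Num.conj /= oppr0. Qed.

Lemma preserves_psd_kernels (R : realType) (m : nat) (f : 'rV[R]_m -> R) :
  symmetric_fun f -> preserves_psd (fun x => (f x)%:C%C) ->
  preserves_kernels f.
Proof.
move=> f_sym f_psd T K K_ge0 K_sym K_psd z.
have [T0|T_gt0] := posnP #|T|.
  by rewrite big_pred0 // => a; have := fintype0 a T0.
pose e : 'I_#|T| -> T := enum_val.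
pose d a b := map_mx (real_complex R) (K (e a) (e b)).
have d_sym i j a b : diag_mx (d a b) i j = (diag_mx (d b a) j i)^*.
  rewrite /d K_sym !mxE eq_sym; case: eqP => [->|_] /=.
    by rewrite !mulr1n conj_real.
  by rewrite !mulr0n conjC0.
have d_psd a b : psdmx (diag_mx (d a b)).
  apply/psdmxP; split=> [i j|x]; first by rewrite {1}/d K_sym -/(d b a) d_sym.
  apply: sumr_ge0 => i _; rewrite (bigD1 i) //= big1 ?addr0.
    rewrite !mxE eqxx mulr1n mulrAC mulr_ge0 //.
      by rewrite mulrC mul_conjC_ge0.
    by rewrite ler0c; exact: K_ge0.
  by move=> j ji; rewrite !mxE eq_sym (negbTE ji) mulr0n mulr0 mul0r.
have D_psd : psdmx (\mxblock_(a < #|T|, b < #|T|) diag_mx (d a b)).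
  apply/psdmxP; split=> [s t|].
    by rewrite [LHS]mxE d_sym /mxblock [in RHS]mxE.
  apply: psd_kernel_diag_mxblock => i x.
  pose y a := x (enum_rank a).
  rewrite (eq_bigr (fun a => \sum_b (y (e a))^* * (K (e a) (e b) 0 i)%:C%C *
    y (e b))); last first.
    by move=> a _; apply: eq_bigr => b _; rewrite /y /e !enum_valK mxE.
  have := K_psd i y.
  rewrite (reindex _ (onW_bij _ (@enum_val_bij T))) /=.
  by under eq_bigr do rewrite (reindex _ (onW_bij _ (@enum_val_bij T))) /=.
have /psdmxP[_ F_psd] := f_psd _ _ T_gt0 d_psd D_psd.
rewrite (reindex _ (onW_bij _ (@enum_val_bij T))) /=.
under eq_bigr do rewrite (reindex _ (onW_bij _ (@enum_val_bij T))) /=.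
have := F_psd (z \o e); congr (0 <= _).
apply: eq_bigr => a _; apply: eq_bigr => b _.
by rewrite mxE fun_mx_diag // => x s x_ge0; rewrite f_sym.
Qed.

(** * Forward differences and the Newton interpolation formula *)

Definition fdiff (V W : zmodType) (v : V) (g : V -> W) (x : V) : W :=
  g (x + v) - g x.

Definition fdiffs (V W : zmodType) (s : seq V) (g : V -> W) : V -> W :=
  foldr (@fdiff V W) g s.

Lemma fdiffC (V W : zmodType) (u v : V) (g : V -> W) :
  fdiff u (fdiff v g) = fdiff v (fdiff u g).
Proof.
apply/funext => x; rewrite /fdiff !opprB (addrAC x u v).
by rewrite addrACA [RHS]addrACA [X in _ + X = _]addrC.
Qed.

Lemma fdiffs_rcons (V W : zmodType) (s : seq V) (v : V) (g : V -> W) :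
  fdiffs (rcons s v) g = fdiffs s (fdiff v g).
Proof. exact: foldr_rcons. Qed.

Lemma fdiff_fdiffs (V W : zmodType) (s : seq V) (v : V) (g : V -> W) :
  fdiff v (fdiffs s g) = fdiffs s (fdiff v g).
Proof. by elim: s => //= u s <-; exact: fdiffC. Qed.

(** The word in the steps [v i] with multiplicities [p i]: differencing along it
is the mixed difference of multi-order [p]. *)
Definition steps (I : finType) (V : Type) (v : I -> V) (p : I -> nat) : seq V :=
  flatten [seq nseq (p i) (v i) | i <- enum I].

(** The expansion of the power [n] of the shift [1 + Delta].  The range of the
sum does not depend on [n], since binomial coefficients vanish beyond [n]; hence
one box of multi-indices serves all the coordinates in the general formula. *)
Lemma newton1 (V W : zmodType) (g : V -> W) (x v : V) (N n : nat) :
  (n <= N)%N ->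
  g (x + v *+ n) = \sum_(j < N.+1) fdiffs (nseq j v) g x *+ 'C(n, j).
Proof.
elim: n g => [|n IHn] g leN.
  by rewrite big_ord_recl bin0 addr0 big1 ?addr0.
have -> : g (x + v *+ n.+1) = g (x + v *+ n) + fdiff v g (x + v *+ n).
  by rewrite /fdiff [RHS]addrC subrK -addrA -mulrSr.
rewrite !IHn ?(ltnW leN) // [in RHS]big_ord_recl.
rewrite [X in X + _ = _]big_ord_recl /=.
rewrite !bin0 -addrA; congr (_ + _).
rewrite [X in _ + X]big_ord_recr /= bin_small // mulr0n addr0 -big_split /=.
apply: eq_bigr => j _; rewrite binS mulrnDr; congr (_ + _ *+ _).
by rewrite -fdiff_fdiffs.
Qed.

(** The one-variable formula applied to one step [v i] after the other: the
induction runs over the list of the indices already treated, and the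
multi-indices of the intermediate sums vanish outside this list. *)
Lemma newton (I : finType) (V W : zmodType) (g : V -> W) (x : V) (v : I -> V)
    (N : nat) (n : I -> nat) :
  (forall i, n i <= N)%N ->
  g (x + \sum_i v i *+ n i) =
  \sum_(p : {ffun I -> 'I_N.+1})
     fdiffs (steps v (fun i => p i)) g x *+ \prod_i 'C(n i, p i).
Proof.
move=> leN; rewrite /steps.
pose fam (r : seq I) := pfamily (ord0 : 'I_N.+1) (mem r) (fun=> predT).
transitivity (\sum_(p in fam (enum I))
    fdiffs (flatten [seq nseq (p i : 'I_N.+1) (v i) | i <- enum I]) g x *+
    \prod_(i <- enum I) 'C(n i, p i)); last first.
  apply: eq_big => [p|p _]; last by rewrite big_enum.
  by apply/familyP => i; rewrite /= mem_enum.
rewrite -[in LHS]big_enum; elim: (enum I) (enum_uniq I) x => /= [_ x|i r IHr].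
  rewrite big_nil addr0 (big_pred1 [ffun=> ord0]) => [|p].
    by rewrite big_nil.
  apply/familyP/eqP => /= [Dp|-> {}i]; last by rewrite ffunE !inE.
  by apply/ffunP => i; rewrite ffunE; apply/eqP/Dp.
case/andP=> /negbTE nri {}/IHr IHr x; rewrite big_cons addrA IHr.
rewrite [RHS](partition_big (fun p : {ffun I -> 'I_N.+1} => p i) xpredT) //=.
under eq_bigr do rewrite (@newton1 _ _ _ _ _ N) // -sumrMnl.
rewrite exchange_big /=; apply: eq_bigr => j _.
pose seti j (p : {ffun I -> 'I_N.+1}) := [ffun k => if k == i then j else p k].
(* A multi-index with [p i = j] is determined by its values off [i]. *)
rewrite [RHS](reindex_onto (seti j) (seti ord0)) => [|p]; last first.
  case/andP=> _ /eqP pi.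
  by apply/ffunP => k; rewrite !ffunE; case: eqP => // ->.
apply: eq_big => [p|p _]; last first.
  rewrite ffunE eqxx /fdiffs foldr_cat -mulrnA big_cons ffunE eqxx.
  have Er k : k \in r -> (seti j p) k = p k.
    by rewrite ffunE; case: eqP nri => // -> ->.
  congr (foldr _ (foldr _ _ (flatten _)) _ _ *+ (_ * _)).
    by apply/eq_in_map => k /Er ->.
  by apply: eq_big_seq => k /Er ->.
rewrite !ffunE !eqxx andbT; apply/familyP/andP => [Pp|[Pp p0] k].
  split.
    apply/familyP => k; rewrite ffunE !inE; have := Pp k.
    by case: eqP => [->|_]; rewrite ?inE.
  apply/eqP/ffunP => k; rewrite !ffunE; case: eqP => // ->.
  by have := Pp i; rewrite /= nri inE => /eqP.
have := familyP Pp k; rewrite -(eqP p0) !ffunE !inE.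
by case: eqP => [-> _|]; rewrite ?nri ?inE.
Qed.

Lemma size_steps (I : finType) (V : Type) (v : I -> V) (p : I -> nat) :
  size (steps v p) = (\sum_i p i)%N.
Proof.
rewrite /steps size_flatten /shape -map_comp sumnE big_map big_enum /=.
by apply: eq_bigr => i _; rewrite size_nseq.
Qed.

Lemma map_steps (I : finType) (V W : Type) (k : V -> W) (v : I -> V)
    (p : I -> nat) :
  map k (steps v p) = steps (k \o v) p.
Proof.
rewrite /steps map_flatten -map_comp; congr flatten.
by apply: eq_map => i /=; rewrite map_nseq.
Qed.

Lemma steps_mem (I : finType) (V : eqType) (v : I -> V) (p : I -> nat) u :
  u \in steps v p -> exists i, u = v i.
Proof.
by move=> /flatten_mapP[i _]; rewrite mem_nseq => /andP[_ /eqP->]; exists i.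
Qed.

(** * Iterated differences of kernel-preserving functions *)

Lemma psd_kernel_ge0 (C : numClosedFieldType) (T : finType)
    (K : T -> T -> C) a : psd_kernel K -> 0 <= K a a.
Proof.
move=> /(_ (fun b => (b == a)%:R)).
rewrite (bigD1 a) //= [X in _ + X]big1 ?addr0 => [|b /negbTE ba].
  rewrite (bigD1 a) //= [X in _ + X]big1 ?addr0 => [|b /negbTE ba].
    by rewrite eqxx mulr1 conjC1 mul1r.
  by rewrite ba mulr0.
by rewrite big1 // => c _; rewrite ba conjC0 !mul0r.
Qed.

Lemma preserves_kernels_ge0 (R : realType) (m : nat) (g : 'rV[R]_m -> R)
    (x : 'rV[R]_m) :
  preserves_kernels g -> nonneg_vec x -> 0 <= g x.
Proof.
move=> g_pres x_ge0; rewrite -(@ler0c R).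
apply: (@psd_kernel_ge0 _ unit (fun _ _ => (g x)%:C%C) tt).
apply: (g_pres _ (fun _ _ => x)) => // i z.
have -> F : \sum_(a : unit) F a = F tt :> R[i].
  by rewrite (big_pred1 tt) // => -[].
rewrite (big_pred1 tt); last by case.
rewrite mulrAC mulr_ge0 //; first by rewrite mulrC mul_conjC_ge0.
by rewrite ler0c.
Qed.

(** The kernel [L] below is [K] on the four blocks, plus [v] on the block
[(true, true)].  Its quadratic form at [x] is that of [K] at the sum of the two
halves of [x], plus [v] times the squared modulus of the sum of the entries of
the half [true].  At the vector equal to [z] on this half and to [- z] on the
other one, the image of [L] under [g] gives the quadratic form of
[g K - 2 g K + g (K + v)], which is the difference sought. *)
Lemma preserves_kernels_fdiff (R : realType) (m : nat) (g : 'rV[R]_m -> R)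
    (v : 'rV[R]_m) :
  nonneg_vec v -> preserves_kernels g -> preserves_kernels (fdiff v g).
Proof.
move=> v_ge0 g_pres T K K_ge0 K_sym K_psd z.
have sum_bool F : \sum_(u : bool * T) F u =
    \sum_a F (true, a) + \sum_a F (false, a) :> R[i].
  rewrite (eq_bigr (fun p => F (p.1, p.2))) => [|[]//].
  by rewrite -(pair_bigA _ (fun u a => F (u, a))) /= big_bool.
pose L (u w : bool * T) :=
  K u.2 w.2 + (if u.1 && w.1 then v else 0).
have := g_pres _ L _ _ _ (fun u => (if u.1 then 1 else -1) * z u.2).
have L_ge0 u w : nonneg_vec (L u w).
  move=> i; rewrite mxE addr_ge0 ?K_ge0 //.
  by case: ifP => _; [exact: v_ge0|rewrite mxE].
have L_sym u w : L u w = L w u by rewrite /L K_sym andbC.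
have L_psd i : psd_kernel (fun u w => (L u w 0 i)%:C%C).
  move=> x.
  pose y a := x (true, a) + x (false, a).
  have := K_psd i y => /addr_ge0.
  have : 0 <= (v 0 i)%:C%C * ((\sum_a x (true, a))^* * \sum_a x (true, a)).
    by rewrite mulr_ge0 ?ler0c // mulrC mul_conjC_ge0.
  move=> /[swap] /[apply]; congr (0 <= _).
  rewrite rmorph_sum /= mulr_suml mulr_sumr -big_split sum_bool -big_split /=.
  apply: eq_bigr => a _.
  rewrite !sum_bool mulr_sumr mulr_sumr -!big_split /=.
  apply: eq_bigr => b _; rewrite /L /y /= !mxE /= rmorphD /= rmorphD /=.
  ring.
move=> /(_ L_ge0 L_sym L_psd); congr (0 <= _).
rewrite sum_bool -big_split /=; apply: eq_bigr => a _.
rewrite !sum_bool -!big_split /=; apply: eq_bigr => b _.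
rewrite /L /= !addr0 /fdiff !mul1r !mulN1r rmorphN /= rmorphB /=.
ring.
Qed.

Definition absolutely_monotone (R : realType) (m : nat) (g : 'rV[R]_m -> R) :=
  forall (s : seq 'rV[R]_m) (x : 'rV[R]_m),
    (forall v, v \in s -> nonneg_vec v) -> nonneg_vec x -> 0 <= fdiffs s g x.

Section AbsolutelyMonotone.
Context {R : realType} {m : nat}.
Implicit Types (g : 'rV[R]_m -> R) (x y v : 'rV[R]_m) (s : seq 'rV[R]_m).

Lemma nonneg_vecD x y : nonneg_vec x -> nonneg_vec y -> nonneg_vec (x + y).
Proof. by move=> x0 y0 i; rewrite mxE addr_ge0. Qed.

Lemma absolutely_monotone_fdiff g v : absolutely_monotone g -> nonneg_vec v ->
  absolutely_monotone (fdiff v g).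
Proof.
move=> g_am v0 s x s0 x0; rewrite -fdiffs_rcons; apply: g_am => // u.
by rewrite mem_rcons in_cons => /predU1P[->|/s0].
Qed.

Lemma absolutely_monotone_le g x y : absolutely_monotone g -> nonneg_vec x ->
  (forall i, x 0 i <= y 0 i) -> g x <= g y.
Proof.
move=> g_am x0 xy; rewrite -subr_ge0.
have := g_am [:: y - x] x; rewrite /= /fdiff (addrC x) subrK; apply => //.
by move=> v; rewrite inE => /eqP -> i; rewrite !mxE subr_ge0.
Qed.

(** A difference of step [2 v] is the sum of the differences of step [v] at [x]
and at [x + v], and the latter is the larger one for an absolutely monotone
function; this gains a factor 2 for each step. *)
Lemma fdiffs_double g s x : absolutely_monotone g ->
  (forall v, v \in s -> nonneg_vec v) -> nonneg_vec x ->
  2 ^+ size s * fdiffs s g x <= fdiffs [seq v *+ 2 | v <- s] g x.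
Proof.
elim: s g x => [|v s IHs] g x g_am s0 x0 /=; first by rewrite mul1r.
have v0 : nonneg_vec v by apply: s0; rewrite mem_head.
have {}s0 u : u \in s -> nonneg_vec u.
  by move=> us; apply: s0; rewrite in_cons us orbT.
have gv_am := absolutely_monotone_fdiff g_am v0.
rewrite !fdiff_fdiffs -/(fdiffs _ _).
set s2 := [seq v *+ 2 | v <- s].
have s20 u : u \in s2 -> nonneg_vec u.
  by move=> /mapP[w ws ->] i; rewrite mulr2n nonneg_vecD // ; exact: s0.
have -> : fdiffs s2 (fdiff (v *+ 2) g) x =
    fdiffs s2 (fdiff v g) (x + v) + fdiffs s2 (fdiff v g) x.
  by rewrite -!fdiff_fdiffs /fdiff mulr2n addrA addrA subrK.
have := IHs _ _ gv_am s0 x0; rewrite -/s2 => le1.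
have le2 : fdiffs s2 (fdiff v g) x <= fdiffs s2 (fdiff v g) (x + v).
  rewrite -subr_ge0; apply: (gv_am (v :: s2)) => // u.
  by rewrite in_cons => /predU1P[->|/s20].
by rewrite exprS -mulrA; lra.
Qed.

End AbsolutelyMonotone.

Lemma preserves_kernels_absolutely_monotone (R : realType) (m : nat)
    (g : 'rV[R]_m -> R) : preserves_kernels g -> absolutely_monotone g.
Proof.
move=> g_pres s x s0 x0; apply: preserves_kernels_ge0 x0.
elim: s s0 => //= v s IHs s0; apply: preserves_kernels_fdiff.
  by apply: s0; rewrite mem_head.
by apply: IHs => u us; apply: s0; rewrite in_cons us orbT.
Qed.

(** * Falling factorials on a grid *)

(** With [x = h n], this is [x (x - h) ... (x - (p - 1) h)]. *)
Definition step_ffact (R : nzRingType) (h : R) (n p : nat) : R :=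
  h ^+ p * (n ^_ p)%:R.

Lemma step_ffact_ge0 (R : realType) (h : R) n p :
  0 <= h -> 0 <= step_ffact h n p.
Proof. by move=> h0; rewrite mulr_ge0 ?exprn_ge0. Qed.

(** Factor by factor, [2 n - k >= 2 (n - k)]. *)
Lemma step_ffact_double (R : realType) (h : R) n p : 0 <= h ->
  2 ^+ p * step_ffact h n p <= step_ffact h n.*2 p.
Proof.
move=> h0; rewrite /step_ffact mulrCA ler_wpM2l ?exprn_ge0 //.
rewrite -natrX -natrM ler_nat.
elim: p => [|p IHp]; first by rewrite !ffactn0.
rewrite !ffactnSr expnSr mulnACA leq_mul // mul2n doubleB.
by rewrite leq_sub2l // -addnn leq_addr.
Qed.

(** The subtraction of the ring replaces the truncated one: they differ only when
the other factor vanishes. *)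
Lemma step_ffactS (R : comNzRingType) (h : R) n p :
  step_ffact h n p.+1 = step_ffact h n p * (h * n%:R - h * p%:R).
Proof.
rewrite /step_ffact ffactnSr natrM exprSr.
have [pn|np] := leqP p n; first by rewrite natrB //; ring.
by rewrite ffact_small // !(mul0r, mulr0).
Qed.

Local Open Scope classical_set_scope.

Lemma cvg_step_ffact (R : realType) (h : nat -> R) (n : nat -> nat) (x : R) p :
  h j @[j --> \oo] --> 0 ->
  h j * (n j)%:R @[j --> \oo] --> x ->
  step_ffact (h j) (n j) p @[j --> \oo] --> x ^+ p.
Proof.
move=> h_0 hn_x; elim: p => [|p IHp].
  rewrite expr0; under eq_cvg do rewrite /step_ffact expr0 mul1r ffactn0.
  exact: cvg_cst.
under eq_cvg do rewrite step_ffactS.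
rewrite exprSr; apply: cvgM => //.
have := cvgB hn_x (cvgM h_0 (cvg_cst (p%:R : R))).
by rewrite mul0r subr0; apply.
Qed.

(** * Sums over boxes of multi-indices *)

Definition multi_index (I : finType) (K : nat) (p : {ffun I -> 'I_K}) :
  {ffun I -> nat} := [ffun i => nat_of_ord (p i)].

Lemma sum_box_widen (I : finType) (V : nmodType) (K N : nat)
    (E : {ffun I -> nat} -> V) : (K <= N)%N ->
  \sum_(p : {ffun I -> 'I_K.+1}) E (multi_index p) =
  \sum_(p : {ffun I -> 'I_N.+1} | [forall i, p i <= K]%N) E (multi_index p).
Proof.
move=> KN; pose w (p : {ffun I -> 'I_K.+1}) : {ffun I -> 'I_N.+1} :=
  [ffun i => inord (p i)].
have wE p i : w p i = p i :> nat.
  by rewrite ffunE inordK // ltnS (leq_trans _ KN) // -ltnS.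
rewrite [RHS](reindex_onto w (fun p => [ffun i => inord (p i)])) /=; last first.
  move=> p /forallP pK; apply/ffunP => i; apply: val_inj.
  by rewrite /= wE ffunE inordK // ltnS.
apply: eq_big => [p|p _]; last first.
  by congr E; apply/ffunP => i; rewrite [LHS]ffunE [RHS]ffunE wE.
symmetry; apply/andP; split.
  by apply/forallP => i; rewrite wE -ltnS.
by apply/eqP/ffunP => i; apply: val_inj; rewrite ffunE wE inord_val.
Qed.

Lemma multi_index_inj (I : finType) (K : nat) : injective (@multi_index I K).
Proof.
move=> p q /ffunP pq; apply/ffunP => i; apply: val_inj.
by have := pq i; rewrite !ffunE.
Qed.

Lemma fsum_box (R : realType) (I : finType) (K : nat)
    (E : {ffun I -> nat} -> \bar R) :
  (\sum_(p \in range (@multi_index I K)) E p =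
   \sum_(p : {ffun I -> 'I_K}) E (multi_index p))%E.
Proof.
rewrite -(big_map (@multi_index I K) xpredT).
apply: fsbig_fwiden => [_ [p _ <-]|| _ [/= /mapP[p _ ->] []]].
- by rewrite /= map_f // mem_index_enum.
- by rewrite (map_inj_uniq (@multi_index_inj I K)) index_enum_uniq.
- by exists p.
Qed.

(** Every finite set of multi-indices lies in a box, so the sums over boxes
exhaust the unordered sum; the second bound makes their supremum reach [l]. *)
Lemma esum_box (R : realType) (I : finType) (E : {ffun I -> nat} -> R)
    (l B : R) :
  (forall p, 0 <= E p) ->
  (forall K, \sum_(p : {ffun I -> 'I_K.+1}) E (multi_index p) <= l) ->
  (forall K,
    l <= \sum_(p : {ffun I -> 'I_K.+1}) E (multi_index p) + B / 2 ^+ K) ->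
  (\esum_(p in [set: {ffun I -> nat}]) (E p)%:E = l%:E)%E.
Proof.
move=> E0 E_le E_ge; set S := (\esum_(p in _) _)%E.
have S_le : (S <= l%:E)%E.
  apply: ge_ereal_sup => _ [X [/finite_seqP[r ->] _] <-].
  pose K := (\max_(p <- r) \max_i p i)%N.
  apply: (@le_trans _ _ (\sum_(p \in range (@multi_index I K.+1)) (E p)%:E)%E).
    apply: lee_fsum_nneg_subset => //.
    - exact/finite_image/finite_finset.
    - move=> p /set_mem/= rp; apply/mem_set.
      exists [ffun i => inord (p i)] => //.
      apply/ffunP => i; rewrite !ffunE inordK // ltnS.
      apply: leq_trans (leq_bigmax i) _.
      exact: (@leq_bigmax_seq _ _ xpredT (fun p : {ffun I -> nat} =>
        \max_i p i)%N).
    - by move=> p _; rewrite lee_fin.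
  by rewrite fsum_box sumEFin lee_fin.
have S_ge K : ((\sum_(p : {ffun I -> 'I_K.+1}) E (multi_index p))%:E <= S)%E.
  rewrite -sumEFin -(fsum_box _ (fun p => (E p)%:E)); apply: esum_ge.
  exists (range (@multi_index I K.+1)) => //; split => //.
  exact/finite_image/finite_finset.
have := le_trans (S_ge 0%N) S_le.
case: S S_le S_ge => [s| |] //; last by move=> _ /(_ 0%N).
rewrite lee_fin => s_le S_ge _; congr _%:E; apply/le_anti; rewrite s_le /=.
have cvg_s : s + B * (2^-1 : R) ^+ K @[K --> \oo] --> s + B * 0.
  apply: cvgD; first exact: cvg_cst.
  apply: cvgM; first exact: cvg_cst.
  by apply: cvg_expr; rewrite ger0_norm ?invr_ge0 // invf_lt1 ?ltr1n.
rewrite -[s]addr0 -(mulr0 B); apply: cvgr_to_ge cvg_s _.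
near=> K; rewrite exprVn; apply: le_trans (E_ge K) _.
by rewrite lerD2r -lee_fin.
Unshelve. all: by end_near. Qed.

(** * Newton expansions on the grid of mesh h *)

Section Newton.
Context {R : realType} {m : nat}.
Context (f : 'rV[R]_m -> R) (f_am : absolutely_monotone f).

Definition axis_step (h : R) (i : 'I_m) : 'rV[R]_m := h *: delta_mx 0 i.

(** The divided difference of multi-order [p] at the origin, that is, the
coefficient of the product of the [step_ffact h (n i) (p i)]. *)
Definition newton_coef (h : R) (p : 'I_m -> nat) : R :=
  fdiffs (steps (axis_step h) p) f 0 / \prod_i (h ^+ p i * (p i)`!%:R).

Lemma axis_step_ge0 h i : 0 <= h -> nonneg_vec (axis_step h i).
Proof. by move=> h0 j; rewrite !mxE mulr_ge0. Qed.

Lemma axis_steps_ge0 h p v :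
  0 <= h -> v \in steps (axis_step h) p -> nonneg_vec v.
Proof. by move=> h0 /steps_mem[i ->]; exact: axis_step_ge0. Qed.

Lemma nonneg_vec0 : nonneg_vec (0 : 'rV[R]_m).
Proof. by move=> i; rewrite mxE. Qed.

Lemma newton_coef_ge0 h p : 0 <= h -> 0 <= newton_coef h p.
Proof.
move=> h0; apply: divr_ge0.
  by apply: f_am => [v|]; [exact: axis_steps_ge0|exact: nonneg_vec0].
by apply: prodr_ge0 => i _; rewrite mulr_ge0 ?exprn_ge0.
Qed.

(** Halving the mesh divides the denominator by [2 ^ (\sum_i p i)], and the mixed
difference by at least as much ([fdiffs_double]). *)
Lemma newton_coef_half h p : 0 < h ->
  newton_coef (h / 2) p <= newton_coef h p.
Proof.
move=> h0; have h20 : 0 < h / 2 by rewrite divr_gt0.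
rewrite /newton_coef; set D2 := \prod_i _; set D := \prod_i _.
have D20 : 0 < D2.
  by apply: prodr_gt0 => i _; rewrite mulr_gt0 ?exprn_gt0 // ltr0n fact_gt0.
have -> : D = 2 ^+ (\sum_i p i) * D2.
  rewrite /D /D2 -prodrXr -big_split /=; apply: eq_bigr => i _.
  by rewrite mulrA -exprMn [2 * _]mulrC divfK ?pnatr_eq0.
rewrite invfM mulrA ler_pM2r ?invr_gt0 // ler_pdivlMr ?exprn_gt0 // mulrC.
rewrite -(size_steps (axis_step (h / 2))).
have -> : steps (axis_step h) p =
    [seq v *+ 2 | v <- steps (axis_step (h / 2)) p].
  rewrite map_steps /steps; congr flatten; apply: eq_map => i /=.
  congr nseq; rewrite /axis_step -scaler_nat scalerA; congr (_ *: _).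
  by rewrite mulrC divfK ?pnatr_eq0.
apply: fdiffs_double => // [v|]; last exact: nonneg_vec0.
by apply: axis_steps_ge0; exact: ltW.
Qed.

Lemma newton_coefP (h : R) (N : nat) (n : 'I_m -> nat) :
  0 < h -> (forall i, n i <= N)%N ->
  f (\row_i (h * (n i)%:R)) =
  \sum_(p : {ffun 'I_m -> 'I_N.+1})
     newton_coef h (multi_index p) *
     \prod_i step_ffact h (n i) (multi_index p i).
Proof.
move=> h0 leN.
have -> : \row_i (h * (n i)%:R) = 0 + \sum_i axis_step h i *+ n i.
  apply/rowP => j; rewrite add0r summxE mxE (bigD1 j) //= big1 ?addr0.
    by rewrite mulmxnE !mxE !eqxx mulr1 mulr_natr.
  by move=> i /negbTE ij; rewrite mulmxnE !mxE eqxx eq_sym ij mulr0 mul0rn.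
rewrite (newton f 0 (axis_step h) leN); apply: eq_bigr => p _.
have -> : steps (axis_step h) (fun i => p i) =
    steps (axis_step h) (multi_index p).
  by congr flatten; apply: eq_map => i; rewrite ffunE.
rewrite /newton_coef -mulrA -mulr_natr; congr (_ * _).
have P0 : \prod_i (h ^+ multi_index p i * (multi_index p i)`!%:R) != 0.
  apply/prodf_neq0 => i _.
  by rewrite mulf_neq0 ?expf_neq0 ?gt_eqF // ltr0n fact_gt0.
apply: (mulfI P0); rewrite mulrA mulfV // mul1r natr_prod -big_split /=.
apply: eq_bigr => i _.
by rewrite /step_ffact ffunE -mulrA -natrM mulnC bin_ffact.
Qed.

Definition newton_box_sum (K : nat) (h : R) (n : 'I_m -> nat) : R :=
  \sum_(p : {ffun 'I_m -> 'I_K.+1})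
     newton_coef h (multi_index p) *
     \prod_i step_ffact h (n i) (multi_index p i).

Lemma newton_term_ge0 h (n : 'I_m -> nat) (p : {ffun 'I_m -> nat}) : 0 <= h ->
  0 <= newton_coef h p * \prod_i step_ffact h (n i) (p i).
Proof.
move=> h0; rewrite mulr_ge0 ?newton_coef_ge0 //.
by apply: prodr_ge0 => i _; exact: step_ffact_ge0.
Qed.

(** The expansion over a larger box that contains [n] is exact, and all its
terms are nonnegative. *)
Lemma newton_box_sum_le K h n : 0 < h ->
  newton_box_sum K h n <= f (\row_i (h * (n i)%:R)).
Proof.
move=> h0; pose N := (\max_i n i + K)%N.
rewrite (@newton_coefP h N) //; last first.
  by move=> i; rewrite (leq_trans (leq_bigmax i)) ?leq_addr.
rewrite /newton_box_sum.
rewrite (sum_box_widen (fun p : {ffun 'I_m -> nat} =>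
  newton_coef h p * \prod_i step_ffact h (n i) (p i))
  (leq_addl (\max_i n i) K)).
rewrite [leRHS](bigID (fun p : {ffun 'I_m -> 'I_N.+1} =>
  [forall i, p i <= K]%N)) /=.
by rewrite lerDl sumr_ge0 // => p _; exact/newton_term_ge0/ltW.
Qed.

(** The tail estimate.  A term outside the box has an entry above [K], hence
total degree at least [K]; passing from [n] to [2 n] multiplies it by at least
[2 ^ K], and the sum of all the terms at [2 n] is the value of [f] there.  The
auxiliary box has to contain [2 n] for this last expansion to be exact. *)
Lemma newton_box_sum_ge K h n : 0 < h ->
  f (\row_i (h * (n i)%:R)) <=
  newton_box_sum K h n + f (\row_i (h * (n i).*2%:R)) / 2 ^+ K.
Proof.
move=> h0; pose N := ((\max_i n i).*2 + K)%N.
have n2N i : ((n i).*2 <= N)%N.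
  by rewrite (leq_trans _ (leq_addr _ _)) // leq_double leq_bigmax.
have nN i : (n i <= N)%N by rewrite (leq_trans _ (n2N i)) // -addnn leq_addr.
rewrite (newton_coefP h0 nN) (newton_coefP h0 n2N) /newton_box_sum.
rewrite (sum_box_widen (fun p : {ffun 'I_m -> nat} =>
  newton_coef h p * \prod_i step_ffact h (n i) (p i))
  (leq_addl (\max_i n i).*2 K)).
rewrite [leLHS](bigID (fun p : {ffun 'I_m -> 'I_N.+1} =>
  [forall i, p i <= K]%N)) /=.
rewrite lerD2l ler_pdivlMr ?exprn_gt0 // mulr_suml.
rewrite [leRHS](bigID (fun p : {ffun 'I_m -> 'I_N.+1} =>
  [forall i, p i <= K]%N)) /=.
apply: ler_wpDl; first by apply: sumr_ge0 => p _; exact/newton_term_ge0/ltW.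
apply: ler_sum => p; rewrite negb_forall => /existsP[k]; rewrite -ltnNge => Kp.
rewrite -mulrA ler_wpM2l ?newton_coef_ge0 ?(ltW h0) // mulrC.
apply: (@le_trans _ _
  (\prod_i (2 ^+ multi_index p i * step_ffact h (n i) (multi_index p i)))).
  rewrite [leRHS]big_split /= ler_wpM2r //.
    by apply: prodr_ge0 => i _; exact/step_ffact_ge0/ltW.
  rewrite prodrXr ler_weXn2l ?ler1n //.
  by rewrite (bigD1 k) //= ffunE (leq_trans (ltnW Kp)) ?leq_addr.
apply: ler_prod => i _.
rewrite mulr_ge0 ?exprn_ge0 ?step_ffact_ge0 ?(ltW h0) //=.
exact/step_ffact_double/ltW.
Qed.

End Newton.

(** * Refining the grid *)

Lemma cvg_sum_prod (R : realType) (I J : finType) (F : J -> nat -> R)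
    (G : J -> I -> nat -> R) (F0 : J -> R) (G0 : J -> I -> R) :
  (forall j, F j k @[k --> \oo] --> F0 j) ->
  (forall j i, G j i k @[k --> \oo] --> G0 j i) ->
  \sum_j F j k * \prod_i G j i k @[k --> \oo] --> \sum_j F0 j * \prod_i G0 j i.
Proof.
move=> cF cG; apply: cvg_big => [|j _]; first exact: add_continuous.
apply: cvgM; first exact: cF.
apply: cvg_big => [|i _]; first exact: mul_continuous.
exact: cG.
Qed.

Section Bernstein.
Context {R : realType} {m : nat}.
Context (f : 'rV[R]_m -> R) (f_am : absolutely_monotone f).

Let h (j : nat) : R := 2^-1 ^+ j.

Let h_gt0 j : 0 < h j. Proof. by rewrite exprn_gt0 ?invr_gt0. Qed.

Let h_cvg : h j @[j --> \oo] --> 0.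
Proof. by apply: cvg_expr; rewrite ger0_norm ?invr_ge0 // invf_lt1 ?ltr1n. Qed.

Definition series_coef (p : 'I_m -> nat) : R :=
  limn (fun j => newton_coef f (h j) p).

Lemma newton_coef_cvg p :
  newton_coef f (h j) p @[j --> \oo] --> series_coef p.
Proof.
apply: nonincreasing_is_cvgn.
  apply/nonincreasing_seqP => j; rewrite /h exprSr.
  exact: newton_coef_half.
exists 0 => _ [j _ <-]; exact/newton_coef_ge0/ltW.
Qed.

Lemma series_coef_ge0 p : 0 <= series_coef p.
Proof.
apply: cvgr_to_ge (@newton_coef_cvg p) _; near=> j.
exact/newton_coef_ge0/ltW.
Unshelve. all: by end_near. Qed.

Lemma newton_box_sum_cvg K (n : nat -> 'I_m -> nat) (x : 'rV[R]_m) :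
  (forall i, h j * (n j i)%:R @[j --> \oo] --> x 0 i) ->
  newton_box_sum f K (h j) (n j) @[j --> \oo] -->
  \sum_(p : {ffun 'I_m -> 'I_K.+1})
     series_coef (multi_index p) * \prod_i x 0 i ^+ multi_index p i.
Proof.
move=> hn_x; apply: cvg_sum_prod => [p|p i]; first exact: newton_coef_cvg.
by apply: cvg_step_ffact => //; exact: hn_x.
Qed.

(** The points [h n] and [h (n + 1)] of the grid surround [x].  The box sums at
the former are at most [f x] and tend to the partial sums of the series; the
value of [f] at the latter is at least [f x], and exceeds the box sum by an
error that is bounded through the value of [f] at one fixed point. *)
Lemma absolutely_monotone_series (x : 'rV[R]_m) : nonneg_vec x ->
  (\esum_(p in [set: {ffun 'I_m -> nat}])
     (series_coef p * \prod_i x 0 i ^+ p i)%:E = (f x)%:E)%E.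
Proof.
move=> x0.
pose n j i := Num.truncn (x 0 i / h j).
have n_itv j i : h j * (n j i)%:R <= x 0 i <= h j * (n j i).+1%:R.
  have /andP[nle nlt] := truncn_itv (divr_ge0 (x0 i) (ltW (h_gt0 j))).
  by rewrite mulrC -ler_pdivlMr // nle mulrC -ler_pdivrMr // ltW.
have hS_x i : h j * (n j i).+1%:R @[j --> \oo] --> x 0 i.
  apply: (@squeeze_cvgr _ _ _ _ (fun=> x 0 i) (fun j => x 0 i + h j)).
  - near=> j; have /andP[nle nge] := n_itv j i.
    by rewrite nge -natr1 mulrDr mulr1 lerD2r.
  - exact: cvg_cst.
  - by rewrite -[X in _ --> X]addr0; apply: cvgD => //; exact: cvg_cst.
have hn_x i : h j * (n j i)%:R @[j --> \oo] --> x 0 i.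
  rewrite -[X in _ --> X]subr0.
  under eq_cvg do rewrite -[_%:R](addrK 1) natr1 mulrBr mulr1.
  by apply: cvgB => //; exact: hS_x.
(* [2 (x + 1)] dominates every [2 h (n + 1)], because [h <= 1]. *)
apply: (@esum_box _ _ (fun p => series_coef p * \prod_i x 0 i ^+ p i) _
  (f (\row_i (2 * (x 0 i + 1))))).
- move=> p; rewrite mulr_ge0 ?series_coef_ge0 //.
  by apply: prodr_ge0 => i _; rewrite exprn_ge0.
- move=> K; apply: cvgr_to_le (@newton_box_sum_cvg K _ _ hn_x) _; near=> j.
  apply: le_trans (newton_box_sum_le f_am K (n j) (h_gt0 j)) _.
  apply: absolutely_monotone_le => // i; rewrite mxE.
    by rewrite mulr_ge0 // ltW.
  by have /andP[] := n_itv j i.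
move=> K.
set B := f (\row_i _).
have cvg_up : newton_box_sum f K (h j) (fun i => (n j i).+1) + B / 2 ^+ K
    @[j --> \oo] -->
    \sum_(p : {ffun 'I_m -> 'I_K.+1})
      series_coef (multi_index p) * \prod_i x 0 i ^+ multi_index p i +
    B / 2 ^+ K.
  by apply: cvgD; [exact: newton_box_sum_cvg|exact: cvg_cst].
apply: cvgr_to_ge cvg_up _; near=> j.
apply: (@le_trans _ _ (f (\row_i (h j * (n j i).+1%:R)))).
  apply: absolutely_monotone_le => // i; rewrite mxE.
  by have /andP[] := n_itv j i.
apply: le_trans (newton_box_sum_ge f_am K _ (h_gt0 j)) _.
rewrite lerD2l ler_pM2r ?invr_gt0 ?exprn_gt0 //.
apply: absolutely_monotone_le => // i; rewrite !mxE.
  by rewrite mulr_ge0 // ltW.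
rewrite -mul2n natrM mulrCA ler_pM2l // -natr1 mulrDr mulr1 lerD //.
  by have /andP[] := n_itv j i.
by rewrite exprn_ile1 // ?invr_ge0 // invf_le1 // ler1n.
Unshelve. all: by end_near. Qed.

End Bernstein.

Local Open Scope complex_scope.

(* All terms of the series are nonnegative, so its (unordered) sum is the
   supremum of the finite partial sums, [esum]. *)
Theorem theorem5 (R : realType) (m : nat) (f : 'rV[R]_m -> R)
    (m_gt0 : (0 < m)%N)
    (f_ge0 : forall x : 'rV[R]_m, nonneg_vec x -> 0 <= f x)
    (f_sym : symmetric_fun f)
    (f_psd : preserves_psd (fun x => (f x)%:C)) :
  exists a : {ffun 'I_m -> nat} -> R,
    (forall p, 0 <= a p) /\
    (forall x : 'rV[R]_m, nonneg_vec x ->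
      (\esum_(p in [set: {ffun 'I_m -> nat}])
         (a p * \prod_(i < m) x 0 i ^+ p i)%:E = (f x)%:E)%E).
Proof.
have f_am := preserves_kernels_absolutely_monotone
  (preserves_psd_kernels f_sym f_psd).
exists (series_coef f); split=> [p|x x0]; first exact: series_coef_ge0.
exact: absolutely_monotone_series.
Qed.
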